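(* Let $d\ge 1$, $s\in(0,1)$, $p\in(0,d/s)$ and set $p^*:=\frac{dp}{d-sp}$. There exists a constant $C>0$ depending only on $p,d,s$ such that for every $f\in W^{s,p}(\mathbb{R}^d)$, $$|f(x)|^{p^*}\le C\,\|f\|_{L^{p^*}}^{p^*-p}\int_{\mathbb{R}^d}\frac{|f(x)-f(y)|^p}{|x-y|^{d+ps}}\,dy\qquad\text{for Lebesgue-a.e. }x\in\mathbb{R}^d .$$ In particular, there exists a constant $C'>0$ depending only on $p,d,s$ such that for every $f\in W^{s,p}(\mathbb{R}^d)$, $$\|f\|_{L^{p^*}}\le C'\,\|f\|_{W^{s,p}} .$$
   Context: Functions are real-valued and measurable on $\mathbb{R}^d$. For $p\in(0,\infty)$ and $s\in(0,1)$, $W^{s,p}(\mathbb{R}^d)$ is the set of $f\in L^p(\mathbb{R}^d)$ such that $$[f]_{W^{s,p}}:=\left(\int_{\mathbb{R}^d}\int_{\mathbb{R}^d}\frac{|f(x+h)-f(x)|^p}{|h|^{d+ps}}\,dx\,dh\right)^{1/p}<\infty,$$ and $\|f\|_{W^{s,p}}^p:=\|f\|_{L^p}^p+[f]_{W^{s,p}}^p$. For any exponent $q\in(0,\infty)$, $\|f\|_{L^q}=(\int|f|^q)^{1/q}\in[0,\infty]$. *)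

(* Defs.v *)
From HB Require Import structures.
From mathcomp Require Import all_boot all_order all_algebra.
From mathcomp Require Import all_classical all_reals all_analysis.

Set Implicit Arguments.
Unset Strict Implicit.
Unset Printing Implicit Defensive.

Import Order.TTheory GRing.Theory Num.Theory.
Import numFieldNormedType.Exports.

Local Open Scope classical_set_scope.
Local Open Scope ring_scope.

(* The sigma-algebra generated by the coordinate cylinders is the Borel
   sigma-algebra of R^n, i.e., the n-fold product of that of R. *)
Definition cylinder (R : realType) (n : nat) : set (set 'rV[R]_n) :=
  [set A | exists i : 'I_n, exists2 B : set (measurableTypeR R),
    measurable B & A = (fun v : 'rV[R]_n => v 0 i) @^-1` B].

Definition borel_rV (R : realType) (n : nat) := g_sigma_algebraType (@cylinder R n).

Section product_lebesgue.
Context {R : realType}.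

Definition rV_cons (n : nat) (z : measurableTypeR R * borel_rV R n) :
    borel_rV R n.+1 :=
  row_mx (z.1%:M : 'rV[R]_1) (z.2 : 'rV[R]_n).

Lemma measurable_rV_coord (n : nat) (i : 'I_n) :
  measurable_fun setT
    ((fun v => (v : 'rV[R]_n) 0 i) : borel_rV R n -> measurableTypeR R).
Proof.
move=> _ Y mY; rewrite setTI; apply: sub_sigma_algebra.
by exists i; exists Y.
Qed.

Lemma measurable_funTo_rV (d : measure_display) (T : measurableType d)
    (n : nat) (f : T -> borel_rV R n) :
  (forall i, measurable_fun setT
    ((fun x => (f x : 'rV[R]_n) 0 i) : T -> measurableTypeR R)) ->
  measurable_fun setT f.
Proof.
move=> mf; apply: (@measurability _ _ _ (borel_rV R n) setT f (@cylinder R n)) => //.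
move=> _ [_ [i [B mB ->]] <-].
exact: (mf i measurableT B mB).
Qed.

Lemma measurable_rV_cons (n : nat) : measurable_fun setT (@rV_cons n).
Proof.
apply: measurable_funTo_rV => i; rewrite /rV_cons.
rewrite -[i](@splitK 1 n); case: (fintype.split _) => j /=.
- rewrite (_ : (fun _ => _) = fst); first exact: measurable_fst.
  by apply/funext => z; rewrite (@row_mxEl _ 1 1 n) mxE ord1 eqxx mulr1n.
- rewrite (_ : (fun _ => _) = (fun v : borel_rV R n => (v : 'rV[R]_n) 0 j) \o snd).
    exact: (measurableT_comp (measurable_rV_coord j) measurable_snd).
  by apply/funext => z; rewrite (@row_mxEr _ 1 1 n).
Qed.

Section cons_measure.
Context (n : nat) (m : {sigma_finite_measure set (borel_rV R n) -> \bar R}).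

Definition cons_measure : set (borel_rV R n.+1) -> \bar R :=
  pushforward (@lebesgue_measure R \x m)%E (@rV_cons n).

Let cons_measure0 : cons_measure set0 = 0%E.
Proof. by rewrite /cons_measure /pushforward preimage_set0 measure0. Qed.

Let cons_measure_ge0 A : (0 <= cons_measure A)%E.
Proof. by rewrite /cons_measure /pushforward; exact: measure_ge0. Qed.

Let cons_measure_semi_sigma_additive : semi_sigma_additive cons_measure.
Proof.
exact: (@measure_semi_sigma_additive _ _ _
  (measure_function_pushforward__canonical__measure_function_Measure
    (@lebesgue_measure R \x m)%E (@measurable_rV_cons n))).
Qed.

HB.instance Definition _ := isMeasure.Build _ _ _ cons_measure
  cons_measure0 cons_measure_ge0 cons_measure_semi_sigma_additive.

Lemma cons_measure_sigma_finite : sigma_finite setT cons_measure.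
Proof.
have /sigma_finiteP[F [FT ndF Foo]] := sigma_finiteT (@lebesgue_measure R).
have /sigma_finiteP[G [GT ndG Goo]] := sigma_finiteT m.
pose hd (v : borel_rV R n.+1) : measurableTypeR R :=
  (v : 'rV[R]_(1 + n)) 0 (lshift n ord0).
pose tl (v : borel_rV R n.+1) : borel_rV R n := rsubmx (v : 'rV[R]_(1 + n)).
have mhd : measurable_fun setT hd by exact: measurable_rV_coord.
have mtl : measurable_fun setT tl.
  apply: measurable_funTo_rV => i; rewrite /tl.
  under eq_fun do rewrite mxE.
  exact: (@measurable_rV_coord (1 + n) (rshift 1 i)).
exists (fun k => hd @^-1` F k `&` tl @^-1` G k).
  apply/esym; rewrite -subTset => v _.
  have [i _ Fi] : (\bigcup_i F i) (hd v) by rewrite -FT.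
  have [j _ Gj] : (\bigcup_i G i) (tl v) by rewrite -GT.
  exists (maxn i j) => //; split.
    by have /subsetPset := ndF _ _ (leq_maxl i j); exact.
  by have /subsetPset := ndG _ _ (leq_maxr i j); exact.
move=> k; have [mF Fkoo] := Foo k; have [mG Gkoo] := Goo k; split.
  apply: measurableI; rewrite -[_ @^-1` _]setTI; [exact: mhd|exact: mtl].
rewrite /cons_measure /pushforward.
rewrite (_ : _ @^-1` _ = F k `*` G k).
  by rewrite product_measure1E// lte_mul_pinfty// ge0_fin_numE.
apply/seteqP; rewrite /hd /tl /rV_cons.
by split=> -[x v] /=; rewrite row_mxEl mxE eqxx mulr1n row_mxKr.
Qed.

HB.instance Definition _ := Measure_isSigmaFinite.Build _ _ _
  cons_measure cons_measure_sigma_finite.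

End cons_measure.

Fixpoint product_lebesgue (n : nat) :
    {sigma_finite_measure set (borel_rV R n) -> \bar R} :=
  match n with
  | 0 => \d_(0 : borel_rV R 0)
  | k.+1 => cons_measure (product_lebesgue k)
  end.

End product_lebesgue.

(* R^d with the sigma-algebra of Lebesgue-measurable sets: by Caratheodory's
   construction, Lebesgue measure is the completion of the product measure. *)
Definition lebesgue_rV (R : realType) (d : nat) :=
  caratheodory_type (mu_ext (@product_lebesgue R d)).

Definition lebesgue_measure_rV (R : realType) (d : nat) :
    set (lebesgue_rV R d) -> \bar R :=
  @completed_measure_extension _ _ _ (@product_lebesgue R d).
HB.instance Definition _ (R : realType) (d : nat) :=
  Measure.on (@lebesgue_measure_rV R d).
Arguments lebesgue_measure_rV : clear implicits.

(* The library's norm on 'rV[R]_d is the sup norm. *)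
Definition euclidean_norm (R : realType) (d : nat) (v : 'rV[R]_d) : R :=
  Num.sqrt (\sum_(i < d) v 0 i ^+ 2).

Section fractional_sobolev.
Context {R : realType} {d : nat}.
Variables (s p : R).
Local Notation mu := (lebesgue_measure_rV R d).
Implicit Types f : 'rV[R]_d -> R.

(* The integrand is 0 at h = 0 (division by zero), a negligible set. *)
Definition gagliardo f : \bar R :=
  ((\int[mu]_h \int[mu]_x
     (`|f ((x : 'rV[R]_d) + (h : 'rV[R]_d)) - f x| `^ p
       / euclidean_norm h `^ (d%:R + p * s))%:E) `^ p^-1)%E.

Definition in_sobolev f : Prop :=
  [/\ measurable_fun setT (f : lebesgue_rV R d -> measurableTypeR R),
      ('N[mu]_p%:E[EFin \o f] < +oo)%E &
      (gagliardo f < +oo)%E].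

Definition sobolev_norm f : \bar R :=
  (('N[mu]_p%:E[EFin \o f] `^ p + gagliardo f `^ p) `^ p^-1)%E.

End fractional_sobolev.

Definition sobolev_exponent (R : realType) (d : nat) (s p : R) : R :=
  d%:R * p / (d%:R - s * p).

(* Main.v *)
Require Import Defs.
From HB Require Import structures.
From mathcomp Require Import all_boot all_order all_algebra.
From mathcomp Require Import all_classical all_reals all_analysis.
From mathcomp Require Import measurable_realfun.
From mathcomp Require Import ring lra.

Set Implicit Arguments.
Unset Strict Implicit.
Unset Printing Implicit Defensive.

Import Order.TTheory GRing.Theory Num.Theory.
Import numFieldNormedType.Exports.

Local Open Scope classical_set_scope.
Local Open Scope ring_scope.

(* Fix x with |f x| = 2u > 0 and let E be the set where |f| >= u. By Chebyshev,
   |E| <= u^-q ||f||_q^q; choose a cube Q centred at x with |Q| = 2 |E| (with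
   |E| replaced by its bound). On Q \ E, of measure at least |Q| / 2, one has
   |f x - f y| >= u and |x - y| <= C |Q|^(1/d), which bounds the integral
   over y from below and gives the pointwise inequality, for every x.
   Integrating it in x for the truncations min(|f|, n), whose L^q norms are
   finite, absorbs ||.||_q^(q - p) into the left-hand side; monotone convergence
   then yields the Sobolev inequality. Tonelli and translation invariance
   identify the integrated right-hand side with the Gagliardo seminorm, after
   replacing f by a Borel function almost everywhere equal to it. *)

(** * Completion of a sigma-finite measure *)

Section completion.
Local Open Scope ereal_scope.
Context {d : measure_display} {T : measurableType d} {R : realType}.
Variable mu : {sigma_finite_measure set T -> \bar R}.
Local Notation I := (caratheodory_type (mu_ext mu)).
Local Notation cmu := (@completed_measure_extension _ T R mu).

Lemma measurable_caratheodory (A : set T) :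
  measurable A -> measurable (A : set I).
Proof. exact: caratheodory_measurable_mu_ext. Qed.

Lemma completed_measureE (A : set T) : measurable A -> cmu A = mu A.
Proof. exact: measurable_mu_extE. Qed.

(** Intersect countable measurable covers whose total masses exceed the outer measure by less than
    1/(n+1); if the outer measure is infinite, the whole space serves. *)
Lemma completed_measure_hull (A : set T) :
  exists2 F : set T, measurable F & A `<=` F /\ mu F = mu_ext mu A.
Proof.
have [Aoo|] := eqVneq (mu_ext mu A) +oo.
  exists setT => //; split => //; rewrite Aoo; apply/eqP; rewrite -leye_eq.
  by rewrite -Aoo -measurable_mu_extE//; exact: le_mu_ext.
rewrite -ltey => Aoo.
have coverA n : exists2 C, measurable_cover A C &
    \sum_(k <oo) mu (C k) < mu_ext mu A + n.+1%:R^-1%:E.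
  have Afin : mu_ext mu A \is a fin_num by rewrite ge0_fin_numE// mu_ext_ge0.
  have n0 : (0 < n.+1%:R^-1 :> R)%R by rewrite invr_gt0.
  have [_/= [C AC <-] ?] := lb_ereal_inf_adherent n0 Afin.
  by exists C.
pose C n := projT1 (cid2 (coverA n)).
have mC n : measurable_cover A (C n) by rewrite /C; case: cid2.
have CA n : \sum_(k <oo) mu (C n k) < mu_ext mu A + n.+1%:R^-1%:E.
  by rewrite /C; case: cid2.
pose F := \bigcap_n \bigcup_k C n k.
have mU n : measurable (\bigcup_k C n k).
  by apply: bigcupT_measurable => k; exact: (cover_measurable (mC n)).
have mF : measurable F by exact: bigcapT_measurable.
have AF : A `<=` F by move=> x Ax n _; exact: (cover_subset (mC n)).
exists F => //; split => //; apply/eqP; rewrite eq_le.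
apply/andP; split; last first.
  by rewrite -measurable_mu_extE//; exact: le_mu_ext.
apply/lee_addgt0Pr => _/posnumP[e]; near \oo => n.
apply: (@le_trans _ _ (mu (\bigcup_k C n k))).
  by rewrite le_measure ?inE//; exact: bigcap_inf.
apply: (@le_trans _ _ (\sum_(k <oo) mu (C n k))).
  apply: measure_sigma_subadditive => //.
  by move=> k; exact: (cover_measurable (mC n)).
rewrite (le_trans (ltW (CA n)))// leeD2l// lee_fin ltW//.
by near: n; exact: near_infty_natSinv_lt.
Unshelve. all: by end_near. Qed.

(** Take a measurable hull [F] of [A], then a hull [G] of F minus A, which is null because [A] is
    Caratheodory measurable of finite measure. F minus G lies in [A] and misses only points of
    [G]. *)
Let caratheodory_inner_fin (A : set I) : measurable A -> cmu A < +oo ->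
  exists B M : set T, [/\ measurable B, measurable M, mu M = 0,
    B `<=` A & A `\` B `<=` M].
Proof.
move=> mA Aoo.
have [F mF [AF muF]] := completed_measure_hull A.
have [G mG [FAG muG]] := completed_measure_hull (F `\` A).
have G0 : mu G = 0.
  have mcF := measurable_caratheodory mF.
  have cF : mu_ext mu F = mu_ext mu A by rewrite measurable_mu_extE.
  rewrite muG; transitivity (cmu (F `\` A)) => //.
  (* The measure of F minus A is a difference of two equal finite numbers. *)
  rewrite measureD//; last by rewrite /= /completed_measure_extension cF.
  rewrite setIidr//= /completed_measure_extension cF subee//.
  by rewrite ge0_fin_numE// mu_ext_ge0.
exists (F `\` G), G; split => //.
- exact: measurableD.
- by move=> x [Fx Gx]; apply: contrapT => Ax; apply: Gx; exact: FAG.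
- move=> x [Ax nFG]; apply: contrapT => Gx; apply: nFG; split => //.
  exact: AF.
Qed.

(** Sigma-finiteness reduces this to the finite case on each piece of [A] inside [S n]; unions of
    the inner sets and of the null sets remain measurable, respectively null. *)
Lemma caratheodory_inner (A : set I) : measurable A ->
  exists B M : set T, [/\ measurable B, measurable M, mu M = 0,
    B `<=` A & A `\` B `<=` M].
Proof.
move=> mA.
have [S ST mS] := sigma_finiteT mu.
have /choice[B /choice[M BM]] n : exists B M : set T,
    [/\ measurable B, measurable M, mu M = 0,
    B `<=` A `&` S n & (A `&` S n) `\` B `<=` M].
  have [mSn Sn] := mS n.
  have mcS := measurable_caratheodory mSn.
  apply: caratheodory_inner_fin; first exact: measurableI.
  have cSn : cmu (S n) < +oo.
    by apply: le_lt_trans Sn; rewrite le_eqVlt completed_measureE// eqxx.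
  apply: le_lt_trans cSn.
  by apply: le_measure; rewrite ?inE//; exact: measurableI.
have mM : measurable (\bigcup_n M n).
  by apply: bigcupT_measurable => n; have [] := BM n.
exists (\bigcup_n B n), (\bigcup_n M n); split => //.
- by apply: bigcupT_measurable => n; have [] := BM n.
- apply/negligibleP => //; apply: negligible_bigcup => n.
  by have [_ mMn M0 _ _] := BM n; exact/negligibleP.
- by move=> x [n _ Bx]; have [_ _ _ /(_ x Bx)[]] := BM n.
- move=> x [Ax nB]; have : setT x by [].
  rewrite ST => -[n _ Sx]; exists n => //.
  have [_ _ _ _] := BM n; apply; split => // Bx.
  by apply: nB; exists n.
Qed.

(* Countably many null sets, one per rational superlevel set, are removed. *)
Lemma caratheodory_measurable_fun (f : T -> R) :
  measurable_fun setT (f : I -> measurableTypeR R) ->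
  exists M : set T, [/\ measurable M, mu M = 0 &
    measurable_fun (~` M) (f : T -> measurableTypeR R)].
Proof.
move=> mf.
have /choice[B /choice[M BM]] (q : rat) : exists B M : set T,
    [/\ measurable B, measurable M, mu M = 0,
    B `<=` f @^-1` `]ratr q, +oo[ & f @^-1` `]ratr q, +oo[ `\` B `<=` M].
  apply: caratheodory_inner; rewrite -[X in measurable X]setTI.
  apply: mf => //; exact: measurable_itv.
pose N := \bigcup_q M q.
have mN : measurable N.
  by apply: bigcupT_measurable_rat => q; have [] := BM q.
have N0 : mu N = 0.
  apply/negligibleP => //.
  (* Enumerating the rationals by [unpickle] makes the union a sequence, to which countable
     subadditivity applies. *)
  apply: (@negligibleS _ _ _ _
      (\bigcup_n if unpickle n is Some q then M q else set0)).
    by move=> x [q _ Mx]; exists (pickle q); [exact: Logic.I|rewrite pickleK].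
  apply: negligible_bigcup => n; case: unpickle => [q|].
    by have [_ mMn M0 _ _] := BM q; exact/negligibleP.
  exact: negligible_set0.
exists N; split => //.
move=> mNc.
apply: (measurability _ (RGenOInfty.measurableE R)) => //.
move=> _ [_ [a ->] <-].
(* Off [N], [B q] is the superlevel set of f at level q, and f x > a exactly when f x > q for some
   rational q > a. *)
rewrite (_ : _ `&` _ =
    ~` N `&` \bigcup_(q in [set q : rat | (a < ratr q)%R]) B q).
  apply: measurableI; first exact: measurableC.
  rewrite bigcup_mkcond; apply: bigcupT_measurable_rat => q.
  by case: ifPn => // _; have [] := BM q.
apply/seteqP; split => x [nN].
  rewrite /= in_itv/= andbT => ax; split => //.
  have [q /= ] := rat_in_itvoo ax; rewrite in_itv/= => /andP[aq qx].
  exists q => //; apply: contrapT => nB; apply: nN; exists q => //.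
  have [_ _ _ _] := BM q; apply; split => //=.
  by rewrite in_itv/= qx.
move=> [q /= aq Bx]; split => //=; rewrite in_itv/= andbT (lt_trans aq)//.
have [_ _ _ /(_ x Bx) /= + _] := BM q.
by rewrite in_itv/= andbT.
Qed.

(** * Integration against the completed measure *)

Lemma measurable_id_caratheodory : measurable_fun setT (id : I -> T).
Proof. by move=> _ A mA; rewrite setTI; exact: measurable_caratheodory. Qed.

(** The identity carries the completed measure to [mu], so this is a change of variables. *)
Lemma ge0_integral_completed (f : T -> \bar R) : measurable_fun setT f ->
  (forall x, 0 <= f x) -> \int[cmu]_x f x = \int[mu]_x f x.
Proof.
move=> mf f0.
rewrite -[LHS](@ge0_integral_pushforward _ _ _ _ R _ measurable_id_caratheodory
  cmu setT f) //.
apply: eq_measure_integral => [|? A mA _].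
  exact: measurable_id_caratheodory.
exact: (completed_measureE mA).
Qed.

Lemma completed_ae (M : set T) (P : T -> Prop) : measurable M -> mu M = 0 ->
  (forall x, ~ M x -> P x) -> {ae cmu, forall x, P x}.
Proof.
move=> mM M0 MP; exists M; split.
- exact: measurable_caratheodory.
- by rewrite completed_measureE.
- by move=> x /= nP; apply: contrapT => /MP.
Qed.

Lemma measurable_fun_completed (d' : measure_display) (T' : measurableType d')
  (f : T -> T') : measurable_fun setT f -> measurable_fun setT (f : I -> T').
Proof. by move=> mf; exact: (measurableT_comp mf measurable_id_caratheodory). Qed.

Lemma measurable_caratheodory_null (A M : set T) : measurable M -> mu M = 0 ->
  A `<=` M -> measurable (A : set I).
Proof.
move=> mM M0 AM; apply: measure_is_complete_caratheodory.
exists M; split => //; first exact: measurable_caratheodory.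
by rewrite -M0; exact: completed_measureE.
Qed.

(** A preimage under [f] splits into a part off [M], where [f] is [g], and a part inside the null
    set [M], measurable by completeness. *)
Lemma measurable_fun_completed_ae (d' : measure_display)
    (T' : measurableType d')
    (f g : T -> T') (M : set T) : measurable M -> mu M = 0 ->
  (forall x, ~ M x -> f x = g x) -> measurable_fun setT g ->
  measurable_fun setT (f : I -> T').
Proof.
move=> mM M0 fg mg _ B mB; rewrite setTI.
rewrite (_ : _ @^-1` _ = (g @^-1` B `\` M) `|` (f @^-1` B `&` M)).
  apply: (@measurableU _ I).
    apply: measurable_caratheodory; apply: measurableD => //.
    by rewrite -[X in measurable X]setTI; exact: mg.
  exact: (measurable_caratheodory_null mM M0 (@subIsetr _ _ _)).
apply/seteqP; split => x /=.
  by move=> Bfx; have [Mx|Mx] := pselect (M x); [right|left; rewrite -fg].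
by move=> [[+ /fg ->]|[]].
Qed.

(** This moves integrals of functions measurable only for the completion back to the original
    sigma-algebra, where Tonelli's theorem is applied. *)
Lemma ge0_integral_completed_ae (f g : T -> \bar R) (M : set T) :
  measurable M -> mu M = 0 -> (forall x, ~ M x -> f x = g x) ->
  measurable_fun setT g -> (forall x, 0 <= f x) -> (forall x, 0 <= g x) ->
  \int[cmu]_x f x = \int[mu]_x g x.
Proof.
move=> mM M0 fg mg f0 g0; rewrite -(ge0_integral_completed mg g0).
apply: (@ge0_ae_eq_integral _ I R cmu setT).
- exact: measurableT.
- exact: (measurable_fun_completed_ae mM M0 fg mg).
- exact: measurable_fun_completed.
- by move=> x _; exact: f0.
- by move=> x _; exact: g0.
- by apply: (completed_ae mM M0) => x Mx _; exact: fg.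
Qed.

End completion.

(** * Lebesgue measure on R^n *)

Section product_lebesgue_theory.
Context {R : realType}.

Lemma measurable_addr_measurableTypeR (a : R) :
  measurable_fun setT
    ((fun x => (x + a)%R) : measurableTypeR R -> measurableTypeR R).
Proof.
exact: measurable_funD.
Qed.

(** The translated measure agrees with Lebesgue measure on half-open intervals, which determine
    it. *)
Lemma lebesgue_measure_translation (a : R) (A : set (measurableTypeR R)) :
  measurable A ->
  lebesgue_measure ((fun x => (x + a)%R) @^-1` A) = lebesgue_measure A.
Proof.
move=> mA; apply/esym.
pose nu := measure_function_pushforward__canonical__measure_function_Measure
  (@lebesgue_measure R) (measurable_addr_measurableTypeR a).
apply: (@lebesgue_measure_unique R nu) => // _ [[b c] _ <-] /=.
rewrite /pushforward.
rewrite (_ : _ @^-1` _ = `](b - a)%R, (c - a)]%classic); last first.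
  by apply/seteqP; split => x /=; rewrite !in_itv/= ltrBlDr lerBrDr.
rewrite !lebesgue_measure_itv/= !lte_fin ltrD2r; case: ifPn => // _.
by rewrite -!EFinB opprB addrA subrK.
Qed.

Lemma measurable_rV_add (n : nat) (d : measure_display) (T : measurableType d)
    (f g : T -> borel_rV R n) :
  measurable_fun setT f -> measurable_fun setT g ->
  measurable_fun setT
    ((fun x => (f x : 'rV[R]_n) + (g x : 'rV[R]_n))%R : T -> borel_rV R n).
Proof.
move=> mf mg; apply: measurable_funTo_rV => i.
under eq_fun do rewrite mxE.
apply: measurable_funD.
  exact: (measurableT_comp (measurable_rV_coord i) mf).
exact: (measurableT_comp (measurable_rV_coord i) mg).
Qed.

Lemma measurable_rV_translation (n : nat) (h : 'rV[R]_n) :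
  measurable_fun setT
    ((fun v => (v : 'rV[R]_n) + h) : borel_rV R n -> borel_rV R n).
Proof.
by apply: measurable_rV_add; [exact: measurable_id|exact: measurable_cst].
Qed.

(** Induction on the dimension: slicing along the first coordinate splits the translation into one
    of the tail, covered by the induction hypothesis, and one of the line. *)
Lemma product_lebesgue_translation (n : nat) (h : 'rV[R]_n)
    (A : set (borel_rV R n)) : measurable A ->
  product_lebesgue n ((fun v : 'rV[R]_n => v + h) @^-1` A) =
  product_lebesgue n A.
Proof.
elim: n h A => [|n IH] h A mA.
  rewrite (_ : _ @^-1` A = A)//; apply/seteqP.
  by split => v /=; rewrite (thinmx0 (v + h)%R) (thinmx0 v).
rewrite /= /cons_measure /pushforward.
set B := rV_cons (n := n) @^-1` A.
have mB : measurable B.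
  by rewrite -[B]setTI; apply: measurable_rV_cons.
pose a : R := h 0 (lshift n ord0 : 'I_(1 + n)).
pose k : 'rV[R]_n := rsubmx (h : 'rV[R]_(1 + n)).
pose F (x : measurableTypeR R) := product_lebesgue n (xsection B x).
have mF : measurable_fun setT F by exact: measurable_fun_xsection.
transitivity (\int[@lebesgue_measure R]_x F ((x : R) + a)%R)%E.
  apply: eq_integral => x _ /=.
  transitivity (product_lebesgue n
    ((fun v : 'rV[R]_n => v + k) @^-1` xsection B ((x : R) + a))); last first.
    by apply: IH; exact: measurable_xsection.
  have E (v : 'rV[R]_n) : rV_cons (x, v : borel_rV R n) + h =
      rV_cons ((x + a)%R, v + k : borel_rV R n).
    rewrite /rV_cons /=; apply/rowP => i.
    rewrite -[i](@splitK 1 n) mxE; case: (fintype.split _) => j /=.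
      by rewrite !(@row_mxEl _ 1 1 n) !mxE ord1.
    by rewrite !(@row_mxEr _ 1 1 n) !mxE.
  congr (product_lebesgue n _); apply/seteqP.
  by split => v; rewrite /= /xsection /= !inE /= /B /= E.
rewrite -(@ge0_integral_pushforward _ _ _ _ R _ (measurable_addr_measurableTypeR a)
  lebesgue_measure setT F)//.
apply: eq_measure_integral => [|? C mC _].
  exact: measurable_addr_measurableTypeR.
exact: (lebesgue_measure_translation a mC).
Qed.

(** A sup-norm ball is a product of intervals, so its volume is explicit in every dimension. *)
Definition cube (n : nat) (x : 'rV[R]_n) (r : R) : set (borel_rV R n) :=
  [set y : 'rV[R]_n | forall i, `|x 0 i - y 0 i| <= r].

Lemma measurable_cube (n : nat) (x : 'rV[R]_n) (r : R) :
  measurable (cube x r).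
Proof.
rewrite (_ : cube x r = \big[setI/setT]_(i < n)
    ((fun v : borel_rV R n => (v : 'rV[R]_n) 0 i)
      @^-1` `[x 0 i - r, x 0 i + r]%classic)).
  apply: bigsetI_measurable => i _; rewrite -[X in measurable X]setTI.
  by apply: measurable_rV_coord => //; exact: measurable_itv.
rewrite -bigcap_seq; apply/seteqP; split => y /= xy i.
  by move=> _ /=; have := xy i; rewrite in_itv/= distrC ler_distl.
by have := xy i (mem_index_enum i); rewrite /= in_itv/= distrC ler_distl.
Qed.

(** Induction peels off the first coordinate; in dimension 0 the Dirac mass gives the empty product
    1. *)
Lemma product_lebesgue_cube (n : nat) (x : 'rV[R]_n) (r : R) : 0 <= r ->
  product_lebesgue n (cube x r) = ((2 * r) ^+ n)%:E.
Proof.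
move=> r0; elim: n x => [|n IH] x.
  by rewrite /= diracE mem_set ?expr0//= => -[].
rewrite /= /cons_measure /pushforward.
rewrite (_ : _ @^-1` _ =
  `[x 0 (lshift n ord0 : 'I_(1 + n)) - r,
    x 0 (lshift n ord0 : 'I_(1 + n)) + r]%classic
  `*` cube (rsubmx (x : 'rV[R]_(1 + n))) r).
  rewrite product_measure1E//; last exact: measurable_cube.
  rewrite (IH (rsubmx (x : 'rV[R]_(1 + n)))) /= lebesgue_measure_itv/= lte_fin.
  case: ifPn => [_|].
    by rewrite -EFinB -EFinM; congr EFin; rewrite exprS; congr (_ * _); ring.
  (* A degenerate interval forces r = 0, and both sides vanish. *)
  rewrite ltrD2l -leNgt lerNr => r0'; have -> : r = 0 by lra.
  by rewrite mul0e mulr0 exprS mul0r.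
apply/seteqP; split => -[z v]; rewrite /rV_cons /cube /= in_itv/=.
  move=> xy; split => [|i].
    have := xy (lshift n ord0 : 'I_(1 + n)).
    by rewrite (@row_mxEl _ 1 1 n) mxE eqxx mulr1n distrC ler_distl.
  have := xy (rshift 1 i : 'I_(1 + n)).
  by rewrite (@row_mxEr _ 1 1 n) mxE.
move=> [zr xy] i; rewrite -[i](@splitK 1 n); case: (fintype.split _) => j /=.
  rewrite (@row_mxEl _ 1 1 n) mxE ord1 eqxx mulr1n distrC ler_distl.
  by move: zr.
by have := xy j; rewrite (@row_mxEr _ 1 1 n) mxE.
Qed.

End product_lebesgue_theory.

(** * The pointwise inequality *)

Section euclidean_norm_theory.
Context {R : realType} {n : nat}.
Implicit Types v : 'rV[R]_n.

Lemma euclidean_norm_gt0 v : v != 0 -> 0 < euclidean_norm v.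
Proof.
move=> v0; rewrite sqrtr_gt0 lt_neqAle eq_sym sumr_ge0 ?andbT; last first.
  by move=> i _; exact: sqr_ge0.
apply: contra v0; rewrite psumr_eq0 => [/allP v0|i _]; last exact: sqr_ge0.
apply/eqP/rowP => i; rewrite mxE; apply/eqP.
by have := v0 i (mem_index_enum i); rewrite /= sqrf_eq0.
Qed.

Lemma euclidean_normN v : euclidean_norm (- v) = euclidean_norm v.
Proof. by congr Num.sqrt; apply: eq_bigr => i _; rewrite mxE sqrrN. Qed.

(** Each of the [n] squares is at most r^2; this bounds the distance from the centre of a cube to
    its points. *)
Lemma euclidean_norm_le v (r : R) : 0 <= r -> (forall i, `|v 0 i| <= r) ->
  euclidean_norm v <= Num.sqrt n%:R * r.
Proof.
move=> r0 vr; rewrite -[in leRHS](ger0_norm r0) -sqrtr_sqr -sqrtrM//.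
apply: ler_wsqrtr; rewrite mulr_natl -[n in leRHS]card_ord -sumr_const.
by apply: ler_sum => i _; rewrite -real_normK ?num_real// lerXn2r ?nnegrE.
Qed.

Lemma measurable_euclidean_norm :
  measurable_fun setT (@euclidean_norm R n : borel_rV R n -> measurableTypeR R).
Proof.
rewrite (_ : @euclidean_norm R n = fun v => (\sum_(i < n) v 0 i ^+ 2) `^ 2^-1).
  apply: (measurableT_comp (measurable_powR _)).
  apply: measurable_sum => i; apply: measurable_funX.
  exact: measurable_rV_coord.
by apply/funext => v; rewrite powR12_sqrt ?sumr_ge0// => i _; exact: sqr_ge0.
Qed.

End euclidean_norm_theory.

(** * The energy at a point and its lower bound *)

Section energy.
Context {R : realType} {d : nat}.
Variables (s p : R).
Hypotheses (d_ge1 : (1 <= d)%N) (s_gt0 : 0 < s) (p_gt0 : 0 < p).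
Local Notation mu := (lebesgue_measure_rV R d).

(** The Gagliardo integrand in the variables x and y = x + h. *)
Definition energy_density (f : 'rV[R]_d -> R) (x y : 'rV[R]_d) : R :=
  `|f x - f y| `^ p / euclidean_norm (x - y) `^ (d%:R + p * s).

Definition energy (f : 'rV[R]_d -> R) (x : 'rV[R]_d) : \bar R :=
  (\int[mu]_y (energy_density f x y)%:E)%E.

Lemma energy_density_ge0 f x y : 0 <= energy_density f x y.
Proof. by rewrite divr_ge0 ?powR_ge0. Qed.

Lemma measurable_energy_density f x :
  measurable_fun setT (f : lebesgue_rV R d -> measurableTypeR R) ->
  measurable_fun setT
    (energy_density f x : lebesgue_rV R d -> measurableTypeR R).
Proof.
move=> mf; rewrite /energy_density.
under eq_fun do rewrite -powRN.
apply: measurable_funM.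
  apply: (measurableT_comp (measurable_powR _)).
  apply: (measurableT_comp (@normr_measurable R setT)).
  by apply: measurable_funB; [exact: measurable_cst|exact: mf].
apply: (measurableT_comp (measurable_powR _)).
apply: measurable_fun_completed.
apply: (measurableT_comp measurable_euclidean_norm).
apply: measurable_funTo_rV => i.
under eq_fun do rewrite !mxE.
by apply: measurable_funB => //; exact: measurable_rV_coord.
Qed.

Lemma lebesgue_measure_rV_cube (x : 'rV[R]_d) (r : R) : 0 <= r ->
  mu (cube x r) = ((2 * r) ^+ d)%:E.
Proof.
move=> r0; rewrite -(product_lebesgue_cube x r0).
exact: (@completed_measureE _ _ R (product_lebesgue d) _ (measurable_cube x r)).
Qed.

Lemma measurable_superlevel (f : 'rV[R]_d -> R) (u : R) :
  measurable_fun setT (f : lebesgue_rV R d -> measurableTypeR R) ->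
  measurable ([set y | u <= `|f y|] : set (lebesgue_rV R d)).
Proof.
move=> mf; have mnf : measurable_fun setT
    ((fun y => `|f y|) : lebesgue_rV R d -> measurableTypeR R).
  exact: (measurableT_comp (@normr_measurable R setT) mf).
rewrite (_ : mkset _ = setT `&` (fun y => `|f y|) @^-1` `[u, +oo[%classic).
  by apply: mnf => //; exact: measurable_itv.
by apply/seteqP; split => y; rewrite /= in_itv/= andbT// => -[].
Qed.

(* On a cube of side 2r around x, outside the superlevel set of |f| at level u,
   |f x - f y| >= u; the superlevel set fills at most half of the cube. *)
Lemma energy_ge (f : 'rV[R]_d -> R) x (u r : R) :
  measurable_fun setT (f : lebesgue_rV R d -> measurableTypeR R) ->
  0 < u -> 0 < r -> `|f x| = 2 * u ->
  (mu [set y | u <= `|f y|]%R <= ((2 * r) ^+ d / 2)%:E)%E ->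
  ((u `^ p * ((Num.sqrt d%:R * r) `^ (d%:R + p * s))^-1
     * ((2 * r) ^+ d / 2))%:E <= energy f x)%E.
Proof.
move=> mf u0 r0 fxu; set E := [set y | _] => muE.
have mE : measurable (E : set (lebesgue_rV R d)).
  exact: measurable_superlevel.
have mQ : measurable (cube x r : set (lebesgue_rV R d)).
  by apply: measurable_caratheodory; exact: measurable_cube.
have mA : measurable (cube x r `\` E : set (lebesgue_rV R d)).
  exact: measurableD.
(* [c] will bound the energy density from below on the cube minus [E]. *)
set c := _ * _^-1.
have c0 : 0 <= c by rewrite mulr_ge0 ?invr_ge0 ?powR_ge0.
have muQ := lebesgue_measure_rV_cube x (ltW r0).
apply: (@le_trans _ _ (c%:E * mu (cube x r `\` E))%E).
  rewrite EFinM lee_wpmul2l ?lee_fin//.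
  rewrite measureD//; last by rewrite [X in (X < _)%E]muQ ltry.
  rewrite [X in (_ <= X - _)%E]muQ (_ : (_ / 2)%:E =
      ((2 * r) ^+ d)%:E - ((2 * r) ^+ d / 2)%:E)%E.
    apply: leeB => //; apply: le_trans muE.
    by apply: le_measure; rewrite ?inE//; exact: measurableI.
  by rewrite -EFinB; congr EFin; lra.
have mK : measurable_fun setT
    ((fun y => (energy_density f x y)%:E) : lebesgue_rV R d -> \bar R).
  by apply/measurable_EFinP; exact: measurable_energy_density.
have K0 y : (0 <= (energy_density f x y)%:E)%E.
  by rewrite lee_fin; exact: energy_density_ge0.
rewrite -(@integral_cst _ _ _ mu _ mA c%:E).
apply: (@le_trans _ _
    (\int[mu]_(y in cube x r `\` E) (energy_density f x y)%:E)%E).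
  apply: (@ge0_le_integral _ _ _ mu _ mA).
  - by move=> y _; rewrite lee_fin.
  - exact: measurable_cst.
  - exact: measurable_funTS mK.
  - move=> y [Qy /negP]; rewrite -ltNge => fyu; rewrite lee_fin.
    have fxy : u <= `|f x - f y|.
      by have := ler_distD (f y) (f x) 0; rewrite !subr0; lra.
    (* The values of [f] differ by at least u > 0, so the distance from x to y is positive and
       inversion reverses the order. *)
    have xy : x - y != 0.
      apply: contraTN fxy; rewrite subr_eq0 => /eqP ->.
      by rewrite subrr normr0 -ltNge.
    have N0 := euclidean_norm_gt0 xy.
    apply: ler_pM; rewrite ?invr_ge0 ?powR_ge0//.
      by rewrite ge0_ler_powR ?nnegrE// ltW.
    have d0 : 0 < d%:R :> R by rewrite ltr0n.
    have sd0 : 0 < Num.sqrt d%:R * r by rewrite mulr_gt0// sqrtr_gt0.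
    rewrite lef_pV2 ?posrE ?powR_gt0//.
    rewrite ge0_ler_powR ?nnegrE//.
    + by rewrite addr_ge0 ?ler0n// mulr_ge0// ltW.
    + exact: ltW.
    + exact: ltW.
    + by apply: euclidean_norm_le; [exact: ltW|move=> i; rewrite !mxE].
exact: (@ge0_subset_integral _ _ _ mu _ _ mA measurableT _ mK
  (fun y _ => K0 y) (@subsetT _ _)).
Qed.

End energy.

(** * The critical exponent, Chebyshev's inequality and the choice of the cube *)

Section pointwise.
Context {R : realType} {d : nat}.
Variables (s p : R).
Hypotheses (d_ge1 : (1 <= d)%N) (s_gt0 : 0 < s) (p_gt0 : 0 < p)
  (p_lt : p < d%:R / s).
Local Notation mu := (lebesgue_measure_rV R d).
Local Notation q := (sobolev_exponent d s p).
Local Notation theta := (p * s / d%:R).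

Let d_gt0 : 0 < d%:R :> R.
Proof. by rewrite ltr0n. Qed.

Let sp_lt : s * p < d%:R.
Proof. by rewrite mulrC -ltr_pdivlMr. Qed.

Let d0 : d%:R != 0 :> R. Proof. exact: lt0r_neq0. Qed.

Let dsp0 : d%:R - s * p != 0. Proof. by rewrite gt_eqF// subr_gt0. Qed.

(** This is the scaling balance: for K the q-th power of the L^q norm, K^theta is the power q - p of
    that norm. *)
Lemma sobolev_exponentE : q = p + q * theta.
Proof. by rewrite /sobolev_exponent; field; rewrite d0 dsp0. Qed.

Lemma sobolev_exponent_gt0 : 0 < q.
Proof. by rewrite divr_gt0 ?mulr_gt0// subr_gt0. Qed.

Lemma theta_gt0 : 0 < theta.
Proof. by rewrite divr_gt0// mulr_gt0. Qed.

Lemma sobolev_exponent_gt : p < q.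
Proof.
by rewrite [ltRHS]sobolev_exponentE ltrDl mulr_gt0 ?theta_gt0 ?sobolev_exponent_gt0.
Qed.

(** Chebyshev's inequality: |f|^t is at least u^t on the superlevel set. *)
Lemma superlevel_le (f : 'rV[R]_d -> R) (u K t : R) :
  measurable_fun setT (f : lebesgue_rV R d -> measurableTypeR R) ->
  0 < u -> 0 < t -> (\int[mu]_y (`|f y| `^ t)%:E <= K%:E)%E ->
  (mu [set y | u <= `|f y|]%R <= (K * u `^ (- t))%:E)%E.
Proof.
move=> mf u0 t0 fK; set E := [set y | _].
have mnf : measurable_fun setT
    ((fun y => `|f y|) : lebesgue_rV R d -> measurableTypeR R).
  exact: (measurableT_comp (@normr_measurable R setT) mf).
have mE : measurable (E : set (lebesgue_rV R d)).
  exact: measurable_superlevel.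
have mft : measurable_fun setT
    ((fun y => (`|f y| `^ t)%:E) : lebesgue_rV R d -> \bar R).
  by apply/measurable_EFinP; exact: (measurableT_comp (measurable_powR _) mnf).
have ut0 : 0 < u `^ t by exact: powR_gt0.
have : ((u `^ t)%:E * mu E <= K%:E)%E.
  rewrite -(@integral_cst _ _ _ mu _ mE (u `^ t)%:E); apply: le_trans fK.
  apply: (@le_trans _ _ (\int[mu]_(y in E) (`|f y| `^ t)%:E)%E).
    apply: (@ge0_le_integral _ _ _ mu _ mE).
    - by move=> y _; rewrite lee_fin ltW.
    - exact: measurable_cst.
    - exact: measurable_funTS mft.
    - move=> y; rewrite /E /= => uy.
      by rewrite lee_fin ge0_ler_powR ?nnegrE// ltW.
  apply: (@ge0_subset_integral _ _ _ mu _ _ mE measurableT _ mft) => y _;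
    [by rewrite lee_fin powR_ge0|exact: Logic.I].
by rewrite muleC -lee_pdivlMr// -EFinM powRN.
Qed.

(** The factor 2^q comes from |f x| = 2u, the factor 2 from keeping half of the cube, the power of
    sqrt d / 2 from its size, and 2^theta from its volume being twice Chebyshev's bound. *)
Definition pointwise_constant : R :=
  2 `^ q * (2 * (Num.sqrt d%:R / 2) `^ (d%:R + p * s)) * 2 `^ theta.

Lemma pointwise_constant_gt0 : 0 < pointwise_constant.
Proof. by rewrite !mulr_gt0 ?powR_gt0// divr_gt0// sqrtr_gt0. Qed.

(* The side 2r of the cube is chosen so that Chebyshev's bound on the
   superlevel set is exactly half of the volume (2r)^d. *)
Lemma pointwise_energy (f : 'rV[R]_d -> R) (K : R) x :
  measurable_fun setT (f : lebesgue_rV R d -> measurableTypeR R) ->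
  0 < K -> (\int[mu]_y (`|f y| `^ q)%:E <= K%:E)%E ->
  ((`|f x| `^ q)%:E <= (pointwise_constant * K `^ theta)%:E * energy s p f x)%E.
Proof.
move=> mf K0 fK.
have q0 := sobolev_exponent_gt0.
have Kt : 0 <= pointwise_constant * K `^ theta.
  by rewrite mulr_ge0 ?powR_ge0// ltW// pointwise_constant_gt0.
(* Where f vanishes the left-hand side is 0; elsewhere the level [u] below is positive. *)
have [->|fx0] := eqVneq (f x) 0.
  rewrite normr0 powR0 ?gt_eqF//; apply: mule_ge0; first by rewrite lee_fin.
  by apply: integral_ge0 => y _; rewrite lee_fin energy_density_ge0.
pose u := `|f x| / 2.
have u0 : 0 < u by rewrite divr_gt0// normr_gt0.
have fxu : `|f x| = 2 * u by rewrite /u; lra.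
clearbody u.
pose W := 2 * (K * u `^ (- q)).
have W0 : 0 < W by rewrite !mulr_gt0 ?powR_gt0.
pose r := W `^ d%:R^-1 / 2.
have r0 : 0 < r by rewrite divr_gt0 ?powR_gt0.
have rW : (2 * r) ^+ d = W.
  rewrite (_ : 2 * r = W `^ d%:R^-1); last by rewrite /r; lra.
  by rewrite -powR_mulrn ?powR_ge0// -powRrM mulVf// powRr1// ltW.
have muE : (mu [set y | u <= `|f y|]%R <= ((2 * r) ^+ d / 2)%:E)%E.
  rewrite rW (_ : W / 2 = K * u `^ (- q)); last by rewrite /W; lra.
  exact: superlevel_le.
have := energy_ge d_ge1 s_gt0 p_gt0 mf u0 r0 fxu muE.
move=> /(@lee_wpmul2l R (pointwise_constant * K `^ theta)%:E).
rewrite lee_fin => /(_ Kt); apply: le_trans.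
(* The constant is chosen for equality here: the powers of [W] leave W^(-theta), and
   [sobolev_exponentE] merges u^p with u^(q theta). *)
rewrite -EFinM lee_fin le_eqVlt; apply/orP; left; apply/eqP.
rewrite rW.
have -> : Num.sqrt d%:R * r = (Num.sqrt d%:R / 2) * W `^ d%:R^-1.
  by rewrite /r; lra.
have sd0 : 0 < Num.sqrt d%:R / 2 :> R by rewrite divr_gt0// sqrtr_gt0.
rewrite (powRM _ (ltW sd0) (powR_ge0 _ _)).
rewrite -powRrM mulrDr mulVf// (@powRD _ W);
  last by rewrite (gt_eqF W0) implybT.
rewrite powRr1 ?(ltW W0)// (mulrC d%:R^-1) {2}/W powRM; last 2 first.
  by [].
  by rewrite mulr_ge0 ?powR_ge0// ltW.
rewrite powRM ?powR_ge0 ?(ltW K0)// -powRrM mulNr powRN.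
rewrite fxu powRM ?(ltW u0)// [in u `^ q]sobolev_exponentE.
rewrite (@powRD _ u); last by rewrite (gt_eqF u0) implybT.
rewrite /pointwise_constant; field.
by rewrite (gt_eqF W0) !gt_eqF ?powR_gt0.
Qed.

End pointwise.

(** * The Gagliardo seminorm *)

Section gagliardo_energy.
Context {R : realType} {d : nat}.
Variables (s p : R).
Hypotheses (p_gt0 : 0 < p).
Local Notation mu := (lebesgue_measure_rV R d).
Local Notation pmu := (@product_lebesgue R d).
Implicit Types (f g : 'rV[R]_d -> R).

Lemma measurable_energy_density2 g :
  measurable_fun setT (g : borel_rV R d -> measurableTypeR R) ->
  measurable_fun setT
    ((fun z => (energy_density s p g z.1 z.2)%:E)
      : borel_rV R d * borel_rV R d -> \bar R).
Proof.
move=> mg; apply/measurable_EFinP; rewrite /energy_density.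
under eq_fun do rewrite -powRN.
apply: measurable_funM.
  apply: (measurableT_comp (measurable_powR _)).
  apply: (measurableT_comp (@normr_measurable R setT)).
  apply: measurable_funB.
    exact: (measurableT_comp mg measurable_fst).
  exact: (measurableT_comp mg measurable_snd).
apply: (measurableT_comp (measurable_powR _)).
apply: (measurableT_comp measurable_euclidean_norm).
apply: measurable_funTo_rV => i.
under eq_fun do rewrite !mxE.
apply: measurable_funB.
  exact: (measurableT_comp (measurable_rV_coord i) measurable_fst).
exact: (measurableT_comp (measurable_rV_coord i) measurable_snd).
Qed.

Lemma energy_product_lebesgue g x :
  measurable_fun setT (g : borel_rV R d -> measurableTypeR R) ->
  energy s p g x = (\int[pmu]_y (energy_density s p g x y)%:E)%E.
Proof.
move=> mg; apply: (@ge0_integral_completed _ _ R pmu).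
  have := measurableT_comp (measurable_energy_density2 mg)
    (measurable_pair1 (x : borel_rV R d)); exact.
by move=> y; rewrite lee_fin energy_density_ge0.
Qed.

Lemma measurable_energy g :
  measurable_fun setT (g : borel_rV R d -> measurableTypeR R) ->
  measurable_fun setT (energy s p g : borel_rV R d -> \bar R).
Proof.
move=> mg.
have -> : energy s p g = fubini_F pmu
   ((fun z => (energy_density s p g z.1 z.2)%:E)
      : borel_rV R d * borel_rV R d -> \bar R).
  by apply/funext => x; rewrite energy_product_lebesgue.
apply: measurable_fun_fubini_tonelli_F; first exact: measurable_energy_density2.
by move=> z; rewrite lee_fin energy_density_ge0.
Qed.

(* For f merely Lebesgue measurable, (x, h) |-> f (x + h) need not be measurable
   for the product of the completed sigma-algebras, whence the Borel g. *)
Lemma gagliardo_energy f g (M : set (borel_rV R d)) :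
  measurable M -> pmu M = 0 -> (forall x, ~ M x -> f x = g x) ->
  measurable_fun setT (g : borel_rV R d -> measurableTypeR R) ->
  (gagliardo s p f `^ p = \int[mu]_x energy s p g x)%E.
Proof.
move=> mM M0 fg mg.
(* The powers 1/p and p cancel, the double integral being nonnegative. *)
rewrite /gagliardo -poweRrM mulVf ?gt_eqF// poweRe1; last first.
  apply: integral_ge0 => h _; apply: integral_ge0 => x _.
  by rewrite lee_fin divr_ge0 ?powR_ge0.
(* [F] at (h, x) is the energy density of [g] at x and x + h. *)
pose F (z : borel_rV R d * borel_rV R d) :=
  (energy_density s p g z.2 ((z.2 : 'rV[R]_d) + z.1))%:E.
have F0 z : (0 <= F z)%E by rewrite lee_fin energy_density_ge0.
have mF : measurable_fun setT F.
  apply: (measurableT_comp (measurable_energy_density2 mg)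
    (g := fun z : borel_rV R d * borel_rV R d =>
      (z.2, (z.2 : 'rV[R]_d) + z.1 : borel_rV R d))).
  apply: measurable_fun_pair; first exact: measurable_snd.
  by apply: measurable_rV_add; [exact: measurable_snd|exact: measurable_fst].
have inner (h : 'rV[R]_d) :
  (\int[mu]_x (`|f ((x : 'rV[R]_d) + h) - f x| `^ p
       / euclidean_norm h `^ (d%:R + p * s))%:E =
    \int[pmu]_x F (h : borel_rV R d, x))%E.
  (* For fixed h the integrand involves f at x and at x + h, so the exceptional set is [M] together
     with a translate of it, still null. *)
  pose M' : set (borel_rV R d) := M `|` (fun v : 'rV[R]_d => v + h) @^-1` M.
  have mM' :
      measurable ((fun v : 'rV[R]_d => v + h) @^-1` M : set (borel_rV R d)).
    by rewrite -[X in measurable X]setTI; apply: measurable_rV_translation.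
  apply: (@ge0_integral_completed_ae _ _ R pmu _ _ M').
  - exact: measurableU.
  - apply/negligibleP; first exact: measurableU.
    apply: negligibleU; apply/negligibleP => //.
    by rewrite -M0; exact: product_lebesgue_translation.
  - move=> x; rewrite /M' /= => /not_orP[Mx Mxh].
    rewrite /F /energy_density /= (fg _ Mx) (fg _ Mxh).
    by rewrite distrC opprD addNKr euclidean_normN.
  - exact: (measurableT_comp mF (measurable_pair1 (h : borel_rV R d))).
  - by move=> x; rewrite lee_fin divr_ge0 ?powR_ge0.
  - by move=> x; exact: F0.
(* Both integrals pass to the Borel product measure, where Tonelli's theorem exchanges them. *)
transitivity (\int[mu]_h \int[pmu]_x F (h, x))%E.
  by apply: eq_integral => h _; exact: inner.
transitivity (\int[pmu]_h \int[pmu]_x F (h, x))%E.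
  apply: (@ge0_integral_completed _ _ R pmu).
    exact: (@measurable_fun_fubini_tonelli_F _ _ _ _ _ pmu _ mF).
  by move=> h; apply: integral_ge0 => x _; exact: F0.
rewrite (fubini_tonelli F mF F0).
transitivity (\int[pmu]_x energy s p g x)%E; last first.
  apply/esym/(@ge0_integral_completed _ _ R pmu).
    exact: measurable_energy.
  by move=> x; apply: integral_ge0 => y _; rewrite lee_fin energy_density_ge0.
apply: eq_integral => x _; rewrite (energy_product_lebesgue x mg).
pose G (y : borel_rV R d) := (energy_density s p g x y)%:E.
have mG : measurable_fun setT G.
  have := measurableT_comp (measurable_energy_density2 mg)
    (measurable_pair1 (x : borel_rV R d)); exact.
(* Substitute y = h + x, by translation invariance. *)
transitivity (\int[pmu]_h G ((h : 'rV[R]_d) + x)%R)%E.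
  by apply: eq_integral => h _; rewrite /F /G /= addrC.
rewrite -[LHS](@ge0_integral_pushforward _ _ _ _ R _
  (measurable_rV_translation x) pmu setT G)//.
  apply: eq_measure_integral => [|? C mC _].
    exact: measurable_rV_translation.
  exact: (product_lebesgue_translation x mC).
by move=> y _; rewrite lee_fin energy_density_ge0.
Qed.

End gagliardo_energy.

(** * The Sobolev inequality *)

Section sobolev.
Context {R : realType} {d : nat}.
Variables (s p : R).
Hypotheses (d_ge1 : (1 <= d)%N) (s_gt0 : 0 < s) (p_gt0 : 0 < p)
  (p_lt : p < d%:R / s).
Local Notation mu := (lebesgue_measure_rV R d).
Local Notation pmu := (@product_lebesgue R d).
Local Notation q := (sobolev_exponent d s p).
Local Notation c := (@pointwise_constant R d s p).
Implicit Types (f g : 'rV[R]_d -> R).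

Lemma measurable_powR_norm (t : R) g :
  measurable_fun setT (g : borel_rV R d -> measurableTypeR R) ->
  measurable_fun setT ((fun y => (`|g y| `^ t)%:E) : borel_rV R d -> \bar R).
Proof.
move=> mg; apply/measurable_EFinP.
apply: (measurableT_comp (measurable_powR _)).
exact: (measurableT_comp (@normr_measurable R setT) mg).
Qed.

(** * Truncations and their uniform bound *)

Definition truncation g (n : nat) : 'rV[R]_d -> R :=
  fun x => Num.min `|g x| n%:R.

Lemma truncation_ge0 g n x : 0 <= truncation g n x.
Proof. by rewrite /truncation le_min normr_ge0 ler0n. Qed.

Lemma measurable_truncation g n :
  measurable_fun setT (g : borel_rV R d -> measurableTypeR R) ->
  measurable_fun setT (truncation g n : borel_rV R d -> measurableTypeR R).
Proof.
move=> mg; apply: measurable_minr; last exact: measurable_cst.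
exact: (measurableT_comp (@normr_measurable R setT) mg).
Qed.

(** The map sending t to min(|t|, n) is 1-Lipschitz, so differences do not grow. *)
Lemma energy_truncation g n x :
  measurable_fun setT (g : borel_rV R d -> measurableTypeR R) ->
  measurable_fun setT (truncation g n : borel_rV R d -> measurableTypeR R) ->
  (energy s p (truncation g n) x <= energy s p g x)%E.
Proof.
move=> mg mt; rewrite (energy_product_lebesgue s p x mt).
rewrite (energy_product_lebesgue s p x mg).
apply: (@ge0_le_integral _ _ _ pmu _ measurableT).
- by move=> y _; rewrite lee_fin energy_density_ge0.
- have := (measurableT_comp (measurable_energy_density2 s p mt)
    (measurable_pair1 (x : borel_rV R d))); exact.
- have := (measurableT_comp (measurable_energy_density2 s p mg)
    (measurable_pair1 (x : borel_rV R d))); exact.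
move=> y _; rewrite lee_fin /energy_density ler_wpM2r ?invr_ge0 ?powR_ge0//.
rewrite ge0_ler_powR ?nnegrE//; first exact: ltW.
apply: le_trans (ler_dist_dist (g x) (g y)).
rewrite /truncation; set a := `|g x|; set b := `|g y|.
have [a0 b0] : 0 <= a /\ 0 <= b by split; exact: normr_ge0.
have : 0 <= n%:R :> R by [].
move: n%:R => N N0.
rewrite ler_norml; have := ler_norm (a - b); have := ler_norm (b - a).
by rewrite (distrC b); rewrite !minEle; case: ifPn; case: ifPn; lra.
Qed.

(** Since q > p, min(|g|, n)^q is at most n^(q - p) |g|^p. *)
Lemma integral_truncation_lty g n :
  measurable_fun setT (g : borel_rV R d -> measurableTypeR R) ->
  measurable_fun setT (truncation g n : borel_rV R d -> measurableTypeR R) ->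
  (\int[mu]_x (`|g x| `^ p)%:E < +oo)%E ->
  (\int[mu]_x (`|truncation g n x| `^ q)%:E < +oo)%E.
Proof.
move=> mg mt gp.
apply: (@le_lt_trans _ _ 
    (\int[mu]_x ((n%:R `^ (q - p))%:E * (`|g x| `^ p)%:E))%E).
  apply: (@ge0_le_integral _ _ _ mu _ measurableT).
  - by move=> y _; rewrite lee_fin powR_ge0.
  - exact: (measurable_fun_completed (measurable_powR_norm q mt)).
  - apply: measurable_funeM.
    exact: (measurable_fun_completed (measurable_powR_norm p mg)).
  move=> y _; rewrite -EFinM lee_fin.
  have qp : p < q by exact: sobolev_exponent_gt.
  rewrite (ger0_norm (truncation_ge0 g n y)).
  have [->|t0] := eqVneq (truncation g n y) 0.
    by rewrite powR0 ?mulr_ge0 ?powR_ge0// gt_eqF// (lt_trans p_gt0).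
  rewrite -[in leLHS](subrK p q) (@powRD _ (truncation g n y));
    last by rewrite t0 implybT.
  apply: ler_pM; rewrite ?powR_ge0//.
    rewrite ge0_ler_powR ?nnegrE ?truncation_ge0 ?subr_ge0 ?(ltW qp)//.
    by rewrite /truncation ge_min lexx orbT.
  rewrite ge0_ler_powR ?nnegrE ?truncation_ge0 ?(ltW p_gt0)//.
  by rewrite /truncation ge_min lexx.
rewrite (@ge0_integralZl_EFin _ _ _ mu _ measurableT _ _
  (measurable_fun_completed (measurable_powR_norm p mg))).
- by rewrite lte_mul_pinfty// lee_fin powR_ge0.
- by move=> y _; rewrite lee_fin powR_ge0.
- exact: powR_ge0.
Qed.

(** With K the finite integral on the left, integrating the pointwise inequality gives K <= c
    K^theta G; dividing by K^theta yields a bound free of [n]. *)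
Lemma truncation_bound g n (G : R) :
  measurable_fun setT (g : borel_rV R d -> measurableTypeR R) ->
  measurable_fun setT (truncation g n : borel_rV R d -> measurableTypeR R) ->
  (\int[mu]_x (`|g x| `^ p)%:E < +oo)%E ->
  (\int[mu]_x energy s p g x = G%:E)%E ->
  (\int[mu]_x (`|truncation g n x| `^ q)%:E <= ((c * G) `^ (q / p))%:E)%E.
Proof.
move=> mg mt gp gG.
have q0 : 0 < q := sobolev_exponent_gt0 d_ge1 s_gt0 p_gt0 p_lt.
have := integral_truncation_lty mg mt gp.
set X := (X in (X < _)%E -> _) => Xoo.
have X0 : (0 <= X)%E by apply: integral_ge0 => y _; rewrite lee_fin powR_ge0.
have [K XK] : exists K, X = K%:E.
  by exists (fine X); rewrite fineK// ge0_fin_numE.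
rewrite -/X XK lee_fin; move: X0; rewrite XK lee_fin le_eqVlt.
(* For K = 0 the bound is immediate; otherwise K^theta can be divided out. *)
move=> /predU1P[<-|K0]; first exact: powR_ge0.
have c0 : 0 < c := pointwise_constant_gt0 s p d_ge1.
pose th := p * s / d%:R.
have mtm : measurable_fun setT
    (truncation g n : lebesgue_rV R d -> measurableTypeR R).
  exact: measurable_fun_completed.
have XK' : (X <= K%:E)%E by rewrite XK.
have pt x : ((`|truncation g n x| `^ q)%:E <=
    (c * K `^ th)%:E * energy s p g x)%E.
  apply: (le_trans (pointwise_energy d_ge1 s_gt0 p_gt0 p_lt x mtm K0 XK')).
  apply: lee_wpmul2l; last exact: energy_truncation.
  by rewrite lee_fin mulr_ge0 ?powR_ge0// ltW.
have e0 x : (0 <= energy s p g x)%E.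
  by apply: integral_ge0 => y _; rewrite lee_fin energy_density_ge0.
have me : measurable_fun setT (energy s p g : lebesgue_rV R d -> \bar R).
  by apply: measurable_fun_completed; exact: measurable_energy.
have cK0 : 0 <= c * K `^ th by rewrite mulr_ge0 ?powR_ge0// ltW.
have : (K%:E <= (c * K `^ th)%:E * G%:E)%E.
  rewrite -XK -gG -(@ge0_integralZl_EFin _ _ _ mu _ measurableT _ _ me _ cK0);
    last by move=> x _; exact: e0.
  apply: (@ge0_le_integral _ _ _ mu _ measurableT).
  - by move=> y _; rewrite lee_fin powR_ge0.
  - exact: (measurable_fun_completed (measurable_powR_norm q mt)).
  - exact: measurable_funeM.
  - by move=> x _; exact: pt.
rewrite -EFinM lee_fin => KG.
have G0 : 0 <= G.
  by rewrite -lee_fin -gG; apply: integral_ge0 => x _; exact: e0.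
have Kpq : K `^ (p / q) <= c * G.
  (* This is the identity q = p + q theta divided by q. *)
  have -> : p / q = 1 - th.
    have E := @sobolev_exponentE R d s p d_ge1 s_gt0 p_lt.
    apply: (mulIf (lt0r_neq0 q0)); rewrite mulfVK ?gt_eqF//.
    by rewrite mulrBl mul1r mulrC; move: E; rewrite -/th; lra.
  rewrite powRB; last by rewrite (gt_eqF K0) implybT.
  rewrite powRr1 ?(ltW K0)// ler_pdivrMr ?powR_gt0//.
  by rewrite -mulrA (mulrC G) mulrA.
have qp0 : 0 <= q / p by rewrite divr_ge0// ltW.
have := ge0_ler_powR qp0 _ _ Kpq.
rewrite !nnegrE powR_ge0 mulr_ge0 ?(ltW c0)// => /(_ isT isT).
rewrite -powRrM (_ : p / q * (q / p) = 1) ?powRr1 ?(ltW K0)//.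
by field; rewrite !gt_eqF.
Qed.

(** Monotone convergence: at each point the truncations increase and eventually equal |g x|. *)
Lemma integral_truncation_cvg g :
  measurable_fun setT (g : borel_rV R d -> measurableTypeR R) ->
  (\int[mu]_x (`|truncation g n x| `^ q)%:E @[n --> \oo] -->
   \int[mu]_x (`|g x| `^ q)%:E)%E.
Proof.
move=> mg.
have q0 : 0 < q := sobolev_exponent_gt0 d_ge1 s_gt0 p_gt0 p_lt.
have -> : (\int[mu]_x (`|g x| `^ q)%:E =
    \int[mu]_x limn (fun n => (`|truncation g n x| `^ q)%:E))%E.
  apply: eq_integral => x _; apply/esym/lim_near_cst => //.
  near=> n; congr (_ `^ _)%:E; rewrite /truncation.
  rewrite Order.POrderTheory.minEle ifT ?normr_id//.
  by near: n; exact: nbhs_infty_ger.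
apply: (@cvg_monotone_convergence _ _ _ mu _ measurableT
  (fun n x => (`|truncation g n x| `^ q)%:E)).
- move=> n; apply: measurable_fun_completed; apply: measurable_powR_norm.
  exact: measurable_truncation.
- by move=> n x _; rewrite lee_fin powR_ge0.
- move=> x _ m n mn; rewrite lee_fin ge0_ler_powR ?nnegrE ?(ltW q0)//.
  rewrite !ger0_norm ?truncation_ge0// /truncation.
  by rewrite le_min ge_min lexx/= ge_min ler_nat mn orbT.
Unshelve. all: by end_near. Qed.

Lemma LnormE f (t : R) : ('N[mu]_t%:E[EFin \o f] =
  (\int[mu]_x (`|f x| `^ t)%:E) `^ t^-1)%E.
Proof. by rewrite unlock. Qed.

(** Finiteness of the L^p norm gives access to the truncation bound, which is uniform in n and so
    passes to the limit. *)
Lemma sobolev_inequality f : in_sobolev s p f ->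
  ('N[mu]_q%:E[EFin \o f] <= (c `^ p^-1)%:E * sobolev_norm s p f)%E.
Proof.
move=> [mf fp fG].
have q0 : 0 < q := sobolev_exponent_gt0 d_ge1 s_gt0 p_gt0 p_lt.
have c0 : 0 < c := pointwise_constant_gt0 s p d_ge1.
(* Off the Borel null set [M], f is Borel measurable; [g] is f set to 0 on [M]. *)
have [M [mM M0 mfM]] := @caratheodory_measurable_fun _ _ R pmu f mf.
pose g : 'rV[R]_d -> R := (f : borel_rV R d -> measurableTypeR R) \_ (~` M).
have mg : measurable_fun setT (g : borel_rV R d -> measurableTypeR R).
  exact: (measurable_restrictT _ (measurableC mM)).1 mfM.
have fg x : ~ M x -> f x = g x.
  by move=> Mx; rewrite /g patchE mem_set.
have Ifg (t : R) :
    (\int[mu]_x (`|f x| `^ t)%:E = \int[mu]_x (`|g x| `^ t)%:E)%E.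
  have t0 (h : 'rV[R]_d -> R) x : (0 <= (`|h x| `^ t)%:E)%E.
    by rewrite lee_fin powR_ge0.
  have mgt := measurable_powR_norm t mg.
  transitivity (\int[pmu]_x (`|g x| `^ t)%:E)%E.
    apply: (@ge0_integral_completed_ae _ _ R pmu _ _ M mM M0 _ mgt) => // x Mx.
    by rewrite (fg x Mx).
  exact/esym/(@ge0_integral_completed _ _ R pmu _ mgt).
have gG : (\int[mu]_x energy s p g x = gagliardo s p f `^ p)%E.
  by rewrite (gagliardo_energy s p_gt0 mM M0 fg mg).
have Goo : (gagliardo s p f `^ p < +oo)%E by exact: poweR_lty.
have gag0 : (0 <= gagliardo s p f)%E by exact: poweR_ge0.
have gpoo : (\int[mu]_x (`|g x| `^ p)%:E < +oo)%E.
  move: fp; rewrite LnormE -Ifg => /(@poweR_lty _ _ p).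
  rewrite -poweRrM mulVf ?gt_eqF// poweRe1//.
  by apply: integral_ge0 => x _; rewrite lee_fin powR_ge0.
have [G GE] : exists G : R, (gagliardo s p f `^ p = G%:E)%E.
  exists (fine (gagliardo s p f `^ p)).
  by rewrite fineK// ge0_fin_numE ?poweR_ge0.
have G0 : 0 <= G by rewrite -lee_fin -GE poweR_ge0.
have bnd : (\int[mu]_x (`|f x| `^ q)%:E <= ((c * G) `^ (q / p))%:E)%E.
  have cvgt := integral_truncation_cvg mg.
  rewrite Ifg -(cvg_lim _ cvgt)//; apply: lime_le.
    by apply/cvg_ex; eexists; exact: cvgt.
  apply: nearW => n; apply: (truncation_bound mg) => //.
    exact: measurable_truncation.
  by rewrite gG.
rewrite LnormE.
have N1 : ((\int[mu]_x (`|f x| `^ q)%:E) `^ q^-1 <= ((c * G) `^ p^-1)%:E)%E.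
  have -> : ((c * G) `^ p^-1)%:E = (((c * G) `^ (q / p))%:E `^ q^-1)%E.
    rewrite poweR_EFin -powRrM; congr (_ `^ _)%:E; field.
    by rewrite !gt_eqF.
  apply: gt0_ler_poweR => //.
  - by rewrite invr_ge0 ltW.
  - rewrite in_itv/= leey andbT; apply: integral_ge0 => x _.
    by rewrite lee_fin powR_ge0.
  - by rewrite in_itv/= leey andbT lee_fin powR_ge0.
apply: (le_trans N1); rewrite powRM ?(ltW c0)// EFinM.
apply: lee_wpmul2l; first by rewrite lee_fin powR_ge0.
(* [G] is the seminorm term of the Sobolev norm, and the L^p term is nonnegative. *)
rewrite -poweR_EFin /sobolev_norm; apply: gt0_ler_poweR.
- by rewrite invr_ge0 ltW.
- by rewrite in_itv/= leey andbT lee_fin.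
- by rewrite in_itv/= leey andbT adde_ge0 ?poweR_ge0.
- by rewrite GE leeDr ?poweR_ge0.
Qed.

End sobolev.

Theorem proposition2p5 (R : realType) (d : nat) (s p : R)
    (d_ge1 : (1 <= d)%N) (s_gt0 : 0 < s) (s_lt1 : s < 1)
    (p_gt0 : 0 < p) (p_lt : p < d%:R / s) :
  let q := sobolev_exponent d s p in
  let mu := lebesgue_measure_rV R d in
  (exists2 C : R, 0 < C & forall f : 'rV[R]_d -> R, in_sobolev s p f ->
    {ae mu, forall x : 'rV[R]_d,
      ((`|f x| `^ q)%:E <=
       C%:E * 'N[mu]_q%:E[EFin \o f] `^ (q - p) *
       \int[mu]_y (`|f x - f y| `^ p
          / euclidean_norm (x - (y : 'rV[R]_d)) `^ (d%:R + p * s))%:E)%E}) /\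
  (exists2 C' : R, 0 < C' & forall f : 'rV[R]_d -> R, in_sobolev s p f ->
    ('N[mu]_q%:E[EFin \o f] <= C'%:E * sobolev_norm s p f)%E).
Proof.
move=> q mu.
have q0 : 0 < q := sobolev_exponent_gt0 d_ge1 s_gt0 p_gt0 p_lt.
have c0 := pointwise_constant_gt0 s p d_ge1.
set c := pointwise_constant _ _ in c0.
(* The Sobolev inequality comes first: it makes the L^q norm finite, so that its q-th power can
   serve as K in the pointwise inequality. *)
have sob f : in_sobolev s p f ->
    ('N[mu]_q%:E[EFin \o f] <= (c `^ p^-1)%:E * sobolev_norm s p f)%E.
  exact: (sobolev_inequality d_ge1 s_gt0 p_gt0 p_lt).
split; last first.
  by exists (c `^ p^-1); [exact: powR_gt0|exact: sob].
exists c => // f fW; have [mf fp fG] := fW.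
have Noo : ('N[mu]_q%:E[EFin \o f] < +oo)%E.
  apply: (le_lt_trans (sob f fW)).
  rewrite lte_mul_pinfty ?lee_fin ?powR_ge0//.
  apply: poweR_lty; rewrite lte_add_pinfty//; exact: poweR_lty.
have N0 : (0 <= 'N[mu]_q%:E[EFin \o f])%E by exact: Lnorm_ge0.
have [N NE] : exists N : R, ('N[mu]_q%:E[EFin \o f] = N%:E)%E.
  by exists (fine 'N[mu]_q%:E[EFin \o f]); rewrite fineK// ge0_fin_numE.
move: N0; rewrite NE lee_fin le_eqVlt => /predU1P[N0|N0].
  (* If the norm is 0, then f = 0 almost everywhere, and at such points both sides vanish because q
     and q - p are positive. *)
  have := @Lnorm_eq0_eq0 _ _ R mu (EFin \o f) q%:E.
  rewrite NE -N0 lte_fin => /(_ _ q0 erefl) => f0.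
  have : (EFin \o f = \0 %[ae mu])%E by apply: f0; apply/measurable_EFinP.
  apply: (@filterS _ _ (@ae_filter_ringOfSetsType _ (lebesgue_rV R d) R
    (lebesgue_measure_rV R d))) => x /(_ Logic.I) /= [->].
  have qp : q - p != 0 by rewrite gt_eqF// subr_gt0; exact: sobolev_exponent_gt.
  by rewrite normr0 (powR0 qp) powR0 ?gt_eqF// mule0 mul0e.
(* For a positive norm the inequality holds at every point. *)
apply: aeW => x.
have fK : (\int[mu]_y (`|f y| `^ q)%:E <= (N `^ q)%:E)%E.
  by rewrite -poweR_EFin -NE poweR_Lnorm ?gt_eqF.
have Nq0 : 0 < N `^ q by exact: powR_gt0.
have := pointwise_energy d_ge1 s_gt0 p_gt0 p_lt x mf Nq0 fK.
rewrite -powRrM poweR_EFin -EFinM.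
(* This turns (N^q)^theta into N^(q - p). *)
by have -> : q * (p * s / d%:R) = q - p by
  rewrite [in RHS]/q [in RHS]sobolev_exponentE// addrAC subrr add0r.
Qed.
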